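(* The Parker loop is given by the following generating function $\alpha_G:(\mathbb{Z}_2)^{12}\to\mathbb{Z}_2$: $$\alpha_G(x)=\sum_{1\le i\le 11}\Big(x_ix_{i+1}\,(x_{i+5}+x_{i+8}+x_{i+9})+x_ix_{i+2}\,(x_{i+6}+x_{i+8})\Big)+x_{12}\Big(\sum_{1\le i\le 11}x_i+\sum_{1\le i<j\le 11}x_ix_j\Big),$$ where in the first sum the indices $i+k$ are understood modulo $11$, with representatives in $\{1,\ldots,11\}$. That is, identifying the Golay code $V$ with $(\mathbb{Z}_2)^{12}$ via its basis $\ell_1,\ldots,\ell_{12}$, the factor set $f$ of the Parker loop satisfies, for all $x,y,z\in(\mathbb{Z}_2)^{12}$, $$f(x,y)+f(y,x)=\alpha_G(x+y)+\alpha_G(x)+\alpha_G(y),$$ $$f(y,z)+f(x+y,z)+f(x,y+z)+f(x,y)=\alpha_G(x+y+z)+\alpha_G(x+y)+\alpha_G(x+z)+\alpha_G(y+z)+\alpha_G(x)+\alpha_G(y)+\alpha_G(z).$$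
   Context: Golay code: $V\subset(\mathbb{Z}_2)^{24}$ is the 12-dimensional span of the rows $\ell_1,\ldots,\ell_{12}$ of the matrix $G=(I_{12}\,|\,B)$, where the rows of the $12\times12$ matrix $B$ are, in order: row 1: 101000111011; row 2: 110100011101; row 3: 011010001111; row 4: 101101000111; row 5: 110110100011; row 6: 111011010001; row 7: 011101101001; row 8: 001110110101; row 9: 000111011011; row 10: 100011101101; row 11: 010001110111; row 12: 111111111110. Every vector in $V$ has weight divisible by $4$. The row $\ell_i$ is identified with the $i$-th standard basis vector of $(\mathbb{Z}_2)^{12}$, so $x=(x_1,\ldots,x_{12})$ corresponds to the codeword $\sum_i x_i\ell_i$. Parker loop: it is the code loop of $V$, i.e. the set $\{\pm u_x: x\in V\}$ with $u_x\cdot u_y=(-1)^{f(x,y)}u_{x+y}$, where the factor set $f:V\times V\to\mathbb{Z}_2$ is a function satisfying (values modulo 2): $f(x,x)=\frac14|x|$; $f(x,y)+f(y,x)=\frac12|x\cap y|$; $f(y,z)+f(x+y,z)+f(x,y+z)+f(x,y)=|x\cap y\cap z|$. Here $|x|$ is the weight of the codeword $x$, and $|x\cap y|$ (resp. $|x\cap y\cap z|$) is the number of coordinates in $\{1,\dots,24\}$ in which both $x,y$ (resp. all of $x,y,z$) are nonzero. *)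

(* Defs.v *)
From HB Require Import structures.
From mathcomp Require Import all_boot all_order all_algebra.

Set Implicit Arguments.
Unset Strict Implicit.
Unset Printing Implicit Defensive.

Import GRing.Theory.
Local Open Scope ring_scope.

Definition supp n (v : 'rV['F_2]_n) : {set 'I_n} := [set i | v 0 i != 0].

(* For a doubly even code V, as the Golay code is, both quotients below are
   exact: 4 divides every weight #|supp x|, hence 2 divides every
   #|supp x :&: supp y|. *)
Definition code_loop_factor_set n (V : {vspace 'rV['F_2]_n})
    (f : subvs_of V -> subvs_of V -> 'F_2) : Prop :=
  [/\ forall x : subvs_of V, f x x = (#|supp (vsval x)| %/ 4)%N%:R,
      forall x y : subvs_of V,
        f x y + f y x = (#|supp (vsval x) :&: supp (vsval y)| %/ 2)%N%:R
    & forall x y z : subvs_of V,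
        f y z + f (x + y) z + f x (y + z) + f x y
        = #|supp (vsval x) :&: supp (vsval y) :&: supp (vsval z)|%:R].

Definition golay_B_rows : seq (seq nat) :=
  [:: [:: 1; 0; 1; 0; 0; 0; 1; 1; 1; 0; 1; 1];
     [:: 1; 1; 0; 1; 0; 0; 0; 1; 1; 1; 0; 1];
     [:: 0; 1; 1; 0; 1; 0; 0; 0; 1; 1; 1; 1];
     [:: 1; 0; 1; 1; 0; 1; 0; 0; 0; 1; 1; 1];
     [:: 1; 1; 0; 1; 1; 0; 1; 0; 0; 0; 1; 1];
     [:: 1; 1; 1; 0; 1; 1; 0; 1; 0; 0; 0; 1];
     [:: 0; 1; 1; 1; 0; 1; 1; 0; 1; 0; 0; 1];
     [:: 0; 0; 1; 1; 1; 0; 1; 1; 0; 1; 0; 1];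
     [:: 0; 0; 0; 1; 1; 1; 0; 1; 1; 0; 1; 1];
     [:: 1; 0; 0; 0; 1; 1; 1; 0; 1; 1; 0; 1];
     [:: 0; 1; 0; 0; 0; 1; 1; 1; 0; 1; 1; 1];
     [:: 1; 1; 1; 1; 1; 1; 1; 1; 1; 1; 1; 0]].

Definition golay_B : 'M['F_2]_12 :=
  \matrix_(i, j) (nth 0%N (nth [::] golay_B_rows i) j)%:R.

Definition golay_G : 'M['F_2]_(12, 12 + 12) := row_mx 1%:M golay_B.

Definition golay : {vspace 'rV['F_2]_(12 + 12)} :=
  <<[seq row i golay_G | i : 'I_12]>>%VS.

(* The i-th row of golay_G as an element of the code: vsproj is the identity on
   members of golay, see golay_rowE. *)
Definition golay_row (i : 'I_12) : subvs_of golay :=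
  vsproj golay (row i golay_G).

Lemma golay_rowE i : vsval (golay_row i) = row i golay_G.
Proof. by apply: vsprojK; apply: memv_span; apply: map_f; rewrite mem_enum. Qed.

Definition codeword (x : 'rV['F_2]_12) : subvs_of golay :=
  \sum_(i < 12) x 0 i *: golay_row i.

(* Indices are shifted by one: the variable x_k, 1 <= k <= 12, is the entry
   x 0 (k - 1).  Thus cyc x k, the entry at k %% 11, is x_(k + 1) with index
   read modulo 11 in {1, ..., 11}, and x_12 is x 0 ord_max. *)
Definition cyc (x : 'rV['F_2]_12) (k : nat) : 'F_2 := x 0 (inord (k %% 11)%N).

Definition alpha_G (x : 'rV['F_2]_12) : 'F_2 :=
  \sum_(i < 11)
     (cyc x i * cyc x (i + 1) * (cyc x (i + 5) + cyc x (i + 8) + cyc x (i + 9))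
      + cyc x i * cyc x (i + 2) * (cyc x (i + 6) + cyc x (i + 8)))
  + x 0 ord_max * (\sum_(i < 11) cyc x i
                   + \sum_(i < 11) \sum_(j < 11 | (i < j)%N) cyc x i * cyc x j).

(* Main.v *)
(* Put q(u) = |u| / 4 mod 2 for a codeword u.  In characteristic 2 the supports
   satisfy |u + v| + 2 |u ∩ v| = |u| + |v|, also after intersecting with a third
   support, so the first and second polarizations of q are |u ∩ v| / 2 and
   |u ∩ v ∩ w| mod 2, which are the commutator and the associator of the loop.
   A check of all 4096 codewords shows alpha_G(x) = q(x) + x_12; the linear term
   x_12 disappears under polarization. *)
Require Import Defs.
From mathcomp Require Import all_boot all_order all_algebra.
From mathcomp Require Import ring zify.
Import GRing.Theory.
Local Open Scope ring_scope.

Lemma F2_natr_odd (n : nat) : n%:R = (odd n)%:R :> 'F_2.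
Proof. by rewrite -modn2 Fp_nat_mod. Qed.

Lemma F2_natr_neq0 (a : 'F_2) : (a != 0)%:R = a.
Proof. by case: a => [[|[|k]]] // lt_k2; apply/val_inj. Qed.

Lemma F2_bool_neq0 (b : bool) : (b%:R != 0 :> 'F_2) = b.
Proof. by case: b. Qed.

Lemma F2_natr_addb : {morph (fun b : bool => b%:R : 'F_2) : a b / a (+) b >-> a + b}.
Proof. by move=> a b; rewrite -[RHS]natrD [RHS]F2_natr_odd oddD !oddb. Qed.

Lemma card_sum_bool (T : finType) (A : {set T}) :
  #|A| = (\sum_i (i \in A : nat))%N.
Proof. by rewrite -sum1_card big_mkcond. Qed.

(** Each coordinate in [W] contributes the identity [(a xor b) + 2ab = a + b] between bits. Taking
    [W = setT] serves for the weights, [W = supp u] for intersections with a further support. *)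
Lemma card_suppD n (u v : 'rV['F_2]_n) (W : {set 'I_n}) :
  (#|supp (u + v) :&: W| + (#|supp u :&: supp v :&: W|).*2
   = #|supp u :&: W| + #|supp v :&: W|)%N.
Proof.
rewrite -muln2 !card_sum_bool big_distrl -!big_split; apply: eq_bigr => i _ /=.
(* An entry in ['F_2] is the cast of the test that it is nonzero, so membership in [supp (u + v)]
   becomes an exclusive or. *)
rewrite !inE mxE -{1}(F2_natr_neq0 (u 0 i)) -{1}(F2_natr_neq0 (v 0 i)).
rewrite -F2_natr_addb F2_bool_neq0.
by case: (u 0 i != 0); case: (v 0 i != 0); case: (i \in W).
Qed.

(** By [card_suppD], twice the intersection is a combination of multiples of 4. Dividing by 4 gives
    the formula, where the minus sign of the weight of [u + v] is lost modulo 2. *)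
Lemma doubly_even_capE n (u v : 'rV['F_2]_n) :
    (4 %| #|supp u|)%N -> (4 %| #|supp v|)%N -> (4 %| #|supp (u + v)|)%N ->
  (2 %| #|supp u :&: supp v|)%N /\
  (#|supp u :&: supp v| %/ 2)%N%:R
  = (#|supp (u + v)| %/ 4)%N%:R + (#|supp u| %/ 4)%N%:R + (#|supp v| %/ 4)%N%:R
    :> 'F_2.
Proof.
have := card_suppD _ u v setT; rewrite !setIT => cardD u4 v4 w4.
split; first by lia.
by rewrite -!natrD F2_natr_odd [RHS]F2_natr_odd; congr (nat_of_bool _)%:R; lia.
Qed.

(** This is [card_suppD] with [W = supp u], halved: the associator is the polarization of the
    commutator in its second argument. *)
Lemma even_cap3E n (u v w : 'rV['F_2]_n) :
    (2 %| #|supp u :&: supp v|)%N -> (2 %| #|supp u :&: supp w|)%N ->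
    (2 %| #|supp u :&: supp (v + w)|)%N ->
  #|supp u :&: supp v :&: supp w|%:R
  = (#|supp u :&: supp (v + w)| %/ 2)%N%:R + (#|supp u :&: supp v| %/ 2)%N%:R
    + (#|supp u :&: supp w| %/ 2)%N%:R :> 'F_2.
Proof.
have := card_suppD _ v w (supp u).
rewrite [_ :&: _ :&: supp u]setIC setIA ![_ :&: supp u]setIC => cardD v2 w2 s2.
by rewrite -!natrD F2_natr_odd [RHS]F2_natr_odd; congr (nat_of_bool _)%:R; lia.
Qed.

Lemma codewordE x : vsval (codeword x) = x *m golay_G.
Proof.
rewrite mulmx_sum_row linear_sum; apply: eq_bigr => i _.
by rewrite linearZ /= golay_rowE.
Qed.

Lemma codewordD x y : codeword (x + y) = codeword x + codeword y.
Proof. by apply: val_inj; rewrite linearD /= !codewordE mulmxDl. Qed.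

(* Boolean counterparts of the weight and of alpha_G, which can be evaluated;
   bigop is opaque, hence the explicit folds. *)
Definition fold_ord {T} (op : T -> T -> T) idx n (F : nat -> T) :=
  foldr (fun i => op (F i)) idx (iota 0 n).

Lemma fold_ordE {T} (op : T -> T -> T) idx n (F : nat -> T) :
  fold_ord op idx n F = \big[op/idx]_(i < n) F i.
Proof. by rewrite -(big_mkord xpredT F) unlock /index_iota subn0. Qed.

Lemma F2_fold_addb n (F : nat -> bool) :
  (fold_ord addb false n F)%:R = \sum_(i < n) (F i)%:R :> 'F_2.
Proof. by rewrite fold_ordE (big_morph _ F2_natr_addb (erefl _)). Qed.

Definition bool_weight (b : nat -> bool) : nat :=
  (fold_ord addn 0 12 (fun j => b j)
   + fold_ord addn 0 12 (fun j => fold_ord addb false 12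
       (fun i => b i && odd (nth 0 (nth [::] golay_B_rows i) j))))%N.

Definition bool_alpha (b : nat -> bool) : bool :=
  let c k := b (k %% 11)%N in
  fold_ord addb false 11 (fun i =>
    (c i && c (i + 1)%N && (c (i + 5)%N (+) c (i + 8)%N (+) c (i + 9)%N))
    (+) (c i && c (i + 2)%N && (c (i + 6)%N (+) c (i + 8)%N)))
  (+) (b 11 && (fold_ord addb false 11 c
    (+) fold_ord addb false 11 (fun i =>
          fold_ord addb false 11 (fun j => (i < j)%N && (c i && c j))))).

Definition entry_bool n (x : 'rV['F_2]_n.+1) (k : nat) : bool := x 0 (inord k) != 0.

Lemma card_supp_codeword x :
  #|supp (vsval (codeword x))| = bool_weight (entry_bool _ x).
Proof.
(* The first 12 coordinates of the codeword are [x] itself, the last 12 are [x *m golay_B]. *)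
rewrite codewordE mul_mx_row mulmx1 card_sum_bool big_split_ord /bool_weight.
rewrite !fold_ordE; congr addn; apply: eq_bigr => j _.
  by rewrite inE row_mxEl /entry_bool inord_val.
rewrite inE row_mxEr mxE -[fold_ord _ _ _ _]F2_bool_neq0 F2_fold_addb.
congr (nat_of_bool (_ != 0)); apply: eq_bigr => i _.
by rewrite -mulnb natrM F2_natr_neq0 inord_val mxE -F2_natr_odd.
Qed.

Lemma alpha_GE x : alpha_G x = (bool_alpha (entry_bool _ x))%:R.
Proof.
have cycE k : cyc x k = (entry_bool _ x (k %% 11))%:R by rewrite F2_natr_neq0.
have x12E : x 0 ord_max = (entry_bool _ x 11)%:R.
  by rewrite F2_natr_neq0; congr (x 0 _); apply: val_inj; rewrite /= inordK.
have andE (a b : bool) : (a && b)%:R = a%:R * b%:R :> 'F_2.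
  by rewrite -mulnb natrM.
rewrite /bool_alpha F2_natr_addb andE F2_natr_addb !F2_fold_addb /alpha_G x12E.
congr (_ + _ * (_ + _)).
- by apply: eq_bigr => i _; rewrite !cycE !(F2_natr_addb, andE).
- by apply: eq_bigr => i _; rewrite cycE.
(* The filter [i < j] becomes a Boolean factor of the summand. *)
apply: eq_bigr => i _; rewrite F2_fold_addb big_mkcond /=.
by apply: eq_bigr => j _; rewrite !cycE !andE; case: ifP; rewrite ?mul1r ?mul0r.
Qed.

Fixpoint bitseqs (n : nat) : seq bitseq :=
  if n is m.+1 then
    [seq true :: s | s <- bitseqs m] ++ [seq false :: s | s <- bitseqs m]
  else [:: [::]].

Lemma mem_bitseqs s : s \in bitseqs (size s).
Proof.
by elim: s => //= b s IHs; rewrite mem_cat; apply/orP; case: b; [left | right];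
  apply: map_f.
Qed.

(** The same enumeration also establishes that the code is doubly even. *)
Lemma bool_alpha_weight_check :
  all (fun s => let b := nth false s in let w := bool_weight b in
         (4 %| w)%N && (bool_alpha b == odd (w %/ 4) (+) b 11)) (bitseqs 12).
Proof. by vm_compute. Qed.

(** Both claims read [b] only at the indices 0 to 11, so they are convertible to those for the list
    of its first 12 values, which the check covers. *)
Lemma bool_alpha_weight (b : nat -> bool) :
  (4 %| bool_weight b)%N /\ bool_alpha b = odd (bool_weight b %/ 4) (+) b 11.
Proof.
have := allP bool_alpha_weight_check (mkseq b 12).
by rewrite -{1}(size_mkseq b 12) mem_bitseqs => /(_ isT) /andP[b4 /eqP].
Qed.

Lemma golay_doubly_even x : (4 %| #|supp (vsval (codeword x))|)%N.
Proof. by rewrite card_supp_codeword; case: (bool_alpha_weight (entry_bool _ x)). Qed.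

Lemma alpha_G_weight x :
  alpha_G x = (#|supp (vsval (codeword x))| %/ 4)%N%:R + x 0 ord_max.
Proof.
rewrite alpha_GE (bool_alpha_weight _).2 F2_natr_addb -F2_natr_odd.
rewrite card_supp_codeword F2_natr_neq0; congr (_ + x 0 _).
by apply: val_inj; rewrite /= inordK.
Qed.

Lemma golay_capE x y :
  (2 %| #|supp (vsval (codeword x)) :&: supp (vsval (codeword y))|)%N /\
  (#|supp (vsval (codeword x)) :&: supp (vsval (codeword y))| %/ 2)%N%:R
  = alpha_G (x + y) + alpha_G x + alpha_G y.
Proof.
have two0 : 2 = 0 :> 'F_2 by apply: val_inj.
have := doubly_even_capE _ (vsval (codeword x)) (vsval (codeword y)).
(* The sum of the two codewords is the codeword of [x + y], so all three weights are divisible by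
   4. *)
rewrite -linearD -codewordD !golay_doubly_even => /(_ isT isT isT)[-> ->].
by split=> //; rewrite !alpha_G_weight mxE; ring: two0.
Qed.

Theorem proposition9p2 (f : subvs_of golay -> subvs_of golay -> 'F_2)
    (hf : code_loop_factor_set f) :
  (forall x y : 'rV['F_2]_12,
     f (codeword x) (codeword y) + f (codeword y) (codeword x)
     = alpha_G (x + y) + alpha_G x + alpha_G y)
  /\
  (forall x y z : 'rV['F_2]_12,
     f (codeword y) (codeword z) + f (codeword x + codeword y) (codeword z)
     + f (codeword x) (codeword y + codeword z) + f (codeword x) (codeword y)
     = alpha_G (x + y + z) + alpha_G (x + y) + alpha_G (x + z) + alpha_G (y + z)
       + alpha_G x + alpha_G y + alpha_G z).
Proof.
case: hf => _ comm_f assoc_f; split=> [x y | x y z].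
  by rewrite comm_f (golay_capE x y).2.
have := even_cap3E _ (vsval (codeword x)) (vsval (codeword y)) (vsval (codeword z)).
rewrite assoc_f -linearD -codewordD !(golay_capE _ _).1 => /(_ isT isT isT) ->.
(* Three commutators bring in [alpha_G x] three times, against once on the right; the zero added
   there is then written as the missing pair [alpha_G x + alpha_G x]. *)
rewrite !(golay_capE _ _).2 (addrA x) -[RHS]addr0.
rewrite -(addrr_pchar2 (pchar_Fp (isT : prime 2)) (alpha_G x)); ring.
Qed.
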